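(* Let $G$ be a compactly generated locally compact totally disconnected group. Then $\mathrm{F\o l}^\ast G=0$ if and only if there exists a sequence of locally finite graphs $\Gamma_n$, each admitting a proper transitive action of $G$, which are asymptotically amenable in the sense that there exists a sequence of finite non-empty sets of vertices $A_n\subseteq\Gamma_n$ such that $|\partial A_n|/|A_n|\to 0$.
   Context: Let $\mu$ be a (left) Haar measure on $G$. For $G$ a compactly generated locally compact group, \[ \mathrm{F\o l}^\ast G=\inf_S\inf_U\frac{\mu(US\setminus U)}{\mu(U)}, \] where the infima are over all compact symmetric generating sets $S$ for $G$ and all compact subsets $U\subseteq G$ of positive measure. For a set $A$ of vertices of a graph $\Gamma$, $\partial A$ is the set of vertices that do not belong to $A$ but have a neighbour in $A$. All actions of topological groups on graphs are by graph automorphisms and are continuous, i.e. the induced homomorphism $G\to\mathrm{Aut}(\Gamma)$ is continuous for the topology of pointwise convergence on $\mathrm{Aut}(\Gamma)$. An action is proper if vertex stabilisers are compact in $G$, and transitive if there is a unique orbit of vertices.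
   Formalization: The graphs Γ_n are required to be connected; without this the claim fails, e.g. for the free group of rank 2 acting by translation on the edgeless graph on its elements, whose finite vertex sets have empty boundary although Føl* > 0. *)

(* Defs.v *)
From HB Require Import structures.
From mathcomp Require Import all_boot all_order all_algebra.
From mathcomp Require Import finmap.
From mathcomp Require Import all_classical all_reals all_analysis.

Set Implicit Arguments.
Unset Strict Implicit.
Unset Printing Implicit Defensive.

Import Order.TTheory GRing.Theory Num.Theory.
Import numFieldNormedType.Exports.

Local Open Scope classical_set_scope.
Local Open Scope ring_scope.

(* The [Pointed] structure is only there because the library's generated
   sigma-algebras live on a [pointedType]; the point is arbitrary and unused. *)
HB.structure Definition PreTopologicalGroup :=
  {G of PointedTopological G & monoid.Group G}.

HB.mixin Record PreTopologicalGroup_isTopologicalGroup G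
    & PreTopologicalGroup G := {
  mulg_continuous : continuous (fun x : G * G => (x.1 * x.2)%g) ;
  invg_continuous : continuous (fun x : G => x^-1%g)
}.

#[short(type="topologicalGroupType")]
HB.structure Definition TopologicalGroup :=
  {G of PreTopologicalGroup G & PreTopologicalGroup_isTopologicalGroup G}.

Definition locally_compact_group (G : topologicalGroupType) :=
  hausdorff_space G /\ locally_compact [set: G].

Section Groups.
Variable G : topologicalGroupType.
Implicit Types (S U H : set G) (g x y : G).
Local Open Scope group_scope.

Definition mulset U S : set G := [set x * y | x in U & y in S].

Definition symmetric_set S := [set x^-1 | x in S] = S.

Definition is_subgroup H :=
  [/\ H 1, (forall x y, H x -> H y -> H (x * y)) & (forall x, H x -> H x^-1)].

Definition generates S := smallest is_subgroup S = [set: G].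

Definition compactly_generated := exists2 S, compact S & generates S.

End Groups.

Arguments compactly_generated : clear implicits.

Definition borel (G : topologicalGroupType) := g_sigma_algebraType (@open G).

Section Haar.
Variables (R : realType) (G : topologicalGroupType).
Local Open Scope ereal_scope.

(* A nonzero left-invariant Radon measure on the Borel sets. *)
Record left_haar_measure (mu : {measure set (borel G) -> \bar R}) : Prop := {
  haar_neq0 : 0 < mu [set: borel G] ;
  haar_compact : forall K : set G, compact K -> mu K < +oo ;
  haar_outer : forall A : set (borel G), measurable A ->
    mu A = ereal_inf [set mu O | O in [set O : set G | open O /\ A `<=` O]] ;
  haar_inner : forall O : set G, open O ->
    mu O = ereal_sup [set mu K | K in [set K : set G | compact K /\ K `<=` O]] ;
  haar_invariant : forall (g : G) (A : set (borel G)), measurable A ->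
    mu [set (g * x)%g | x in (A : set G)] = mu A
}.

Definition folner_star (mu : {measure set (borel G) -> \bar R}) : \bar R :=
  ereal_inf
    [set ereal_inf
      [set mu (mulset U S `\` U) / mu U | U in
        [set U : set G | compact U /\ 0 < mu U]]
    | S in [set S : set G | [/\ compact S, symmetric_set S & generates S]]].

End Haar.

Record graph := Graph {
  vertex :> choiceType ;
  adj : rel vertex ;
  adj_sym : symmetric adj ;
  adj_irr : irreflexive adj
}.

Section Graphs.
Variable Gamma : graph.

(* Graphs acted on are understood to be connected: otherwise the edgeless graph
   on G / K, with K a compact open subgroup, would always be amenable. *)
Definition connected_graph :=
  forall x y : Gamma, exists p : seq Gamma, path (@adj Gamma) x p /\ last x p = y.

Definition locally_finite :=
  forall x : Gamma, finite_set [set y : Gamma | adj x y].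

Definition vertex_boundary (A : set Gamma) : set Gamma :=
  [set y | ~ A y /\ exists2 x, A x & adj x y].

End Graphs.

Arguments connected_graph : clear implicits.
Arguments locally_finite : clear implicits.

Section Actions.
Variables (G : topologicalGroupType) (Gamma : graph).
Implicit Type act : G -> Gamma -> Gamma.

(* Aut(Gamma) carries the topology of pointwise convergence inherited from the
   functions Gamma -> Gamma, the vertex set being discrete. *)
Record graph_action act : Prop := {
  action1 : forall x, act 1%g x = x ;
  actionM : forall g h x, act (g * h)%g x = act g (act h x) ;
  action_adj : forall g x y, adj (act g x) (act g y) = adj x y ;
  action_continuous :
    continuous (act : G -> {ptws Gamma -> discrete_topology Gamma})
}.

Definition proper_action act :=
  forall x, compact [set g : G | act g x = x].

Definition transitive_action act :=
  exists x, [set act g x | g in [set: G]] = [set: Gamma].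

Definition admits_proper_transitive_action :=
  exists act, [/\ graph_action act, proper_action act & transitive_action act].

End Actions.

Definition asymptotically_amenable (R : realType) (Gamma : nat -> graph) :=
  exists A : forall n, set (Gamma n),
    (forall n, finite_set (A n) /\ A n !=set0) /\
    ((fun n => #|` fset_set (vertex_boundary (A n))|%:R
               / #|` fset_set (A n)|%:R : R)%R @ \oo --> (0 : R)%R).

(* Main.v *)
Require Import Defs.
From mathcomp Require Import all_boot all_order all_algebra.
From mathcomp Require Import finmap.
From mathcomp Require Import all_classical all_reals all_analysis.

(** Both directions rest on one dictionary. Let K be a compact open subgroup of
    G and pi the projection of G onto the coset space G / K. Finite sets A of
    cosets correspond to compact open sets pi^-1(A) that are invariant under
    right translation by K, and mu (pi^-1 A) = |A| mu K with 0 < mu K < oo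
    ([haar_coset_preimage], [haar_coset_gt0]). A proper transitive action on a
    graph identifies its vertices with such a coset space, K being the
    stabiliser of a base vertex x0 ([orbit_coset_map]).

    Graphs to groups ([folner_star_le]): let S be the set of the s such that
    s x0 is x0 or a neighbour of x0. It is compact by local finiteness,
    symmetric because the action preserves adjacency, and generating because
    the graph is connected. Right multiplication by S moves g x0 to itself or
    to a neighbour, so for U = pi^-1(A) the set US \ U is exactly the preimage
    of the vertex boundary of A. Hence the ratio of measures is the ratio of
    cardinals, and Fol* is at most |dA| / |A|.

    Groups to graphs ([folner_star_lt_graph]): let S and U be compact with
    mu (US \ U) < e mu U. Outer regularity gives an open V containing US with
    mu (V \ U) < e mu U ([haar_thicken]), and compactness gives a neighbourhood
    W of 1 with UWSW contained in V ([mulset_thicken]). By van Dantzig's theorem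
    ([compact_open_subgroup_nbhs]) W contains a compact open subgroup K. Join
    two distinct cosets gK and hK when g^-1 h lies in KSK: this Cayley-Abels
    graph is connected since S generates, locally finite since KSK is compact,
    and G acts on it by translation. The preimage of the image A of U is UK,
    and the preimage of the boundary of A is contained in UKSK \ UK, hence in
    V \ U. Dividing by mu K gives |dA| / |A| < e.

    Van Dantzig's theorem comes from the fact that, in a compact Hausdorff
    space, the intersection of all clopen sets around a point is connected, so
    that total disconnectedness yields a base of clopen neighbourhoods. *)

Set Implicit Arguments.
Unset Strict Implicit.
Unset Printing Implicit Defensive.

Import Order.TTheory GRing.Theory Num.Theory.
Import numFieldNormedType.Exports.

Local Open Scope classical_set_scope.
Local Open Scope ring_scope.

(** * Clopen neighbourhoods in totally disconnected spaces *)

Section QuasiComponents.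
Variable T : topologicalType.
Implicit Types (K A B C O : set T) (x y : T).

(** Each y in B has a neighbourhood missed by some member of F; finitely many of
    these neighbourhoods cover B, and F contains the intersection of the
    corresponding members. With the closure in the conclusion, the complement
    of [closure U] is an open neighbourhood of B. *)
Lemma compact_avoid_cluster B (F : set_system T) : Filter F -> compact B ->
  (forall y, B y -> ~ cluster F y) -> exists2 U, F U & closure U `&` B = set0.
Proof.
move=> FF /compact_near_coveringP cB BF.
have [F0|nF0] := pselect (F set0).
  by exists set0 => //; rewrite closure0 set0I.
have PF : ProperFilter F by [].
have /(cB _ (powerset_filter_from F)) : forall y, B y ->
    \forall y' \near y & U \near powerset_filter_from F, ~ closure U y'.
  move=> y /BF /existsNP[U /existsNP[V /not_implyP[FU /not_implyP[yV UV0]]]].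
  near=> y' W => clW; apply: UV0.
  have : nbhs y' V by near: y'; exact: nbhs_interior.
  move=> /clW[z [Wz Vz]]; exists z; split => //.
  exact: (near (small_set_sub FU) W).
case=> G [GF _ [U GU]] GP; exists U; first exact: GF.
by rewrite -subset0 => z [clUz Bz]; exact: (GP U GU z Bz).
Unshelve. all: by end_near. Qed.

(** The compactness of B separates each point of A from B, and that of A, for
    the filter of open sets around B, makes the separation uniform. *)
Lemma compact_separated A B : hausdorff_space T -> compact A -> compact B ->
  A `&` B = set0 ->
  exists U V, [/\ open U, open V, A `<=` U, B `<=` V & U `&` V = set0].
Proof.
move=> hT cA cB AB0.
pose F := filter_from [set V | open V /\ B `<=` V] id.
have FF : Filter F.
  apply: filter_from_filter; first by exists setT; split => //; exact: openT.
  move=> V W [oV BV] [oW BW]; exists (V `&` W) => //.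
  by split; [exact: openI | rewrite subsetI].
have [|W [V [oV BV] /= VW] WA] := compact_avoid_cluster FF cA.
  move=> x Ax Fx.
  have [|U xU UB] := compact_avoid_cluster (nbhs_filter x) cB.
    by move=> y By /hT xy; rewrite -xy in By; rewrite -[False]/(set0 x) -AB0.
  have [|z [/= nUz Uz]] := Fx (~` closure U) U _ xU.
  - exists (~` closure U) => //; split.
      exact/closed_openC/closed_closure.
    by apply/disjoints_subset; rewrite setIC.
  - by apply: nUz; exact: subset_closure.
exists (~` closure V), V; split => //.
- exact/closed_openC/closed_closure.
- apply/disjoints_subset; rewrite setIC -subset0 -WA.
  by apply: setSI; exact: closureS.
- by rewrite -subset0 => z [/= nV Vz]; apply: nV; exact: subset_closure.
Qed.

(** For closed K these are the clopen subsets of the subspace K, phrased with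
    closed sets of the ambient space. *)
Definition relatively_clopen K C := [/\ C `<=` K, closed C & closed (K `\` C)].

Lemma relatively_clopenI K C C' :
  relatively_clopen K C -> relatively_clopen K C' ->
  relatively_clopen K (C `&` C').
Proof.
move=> [CK cC cKC] [C'K cC' cKC']; split; first by move=> z [/CK].
  exact: closedI.
by rewrite setDIr; exact: closedU.
Qed.

(** Inside C the sets U and V are complements of each other, so the trace of U
    is both the complement of an open set and the trace of one. *)
Lemma relatively_clopen_split K C U V : relatively_clopen K C ->
  open U -> open V -> C `<=` U `|` V -> U `&` V = set0 ->
  relatively_clopen K (C `&` U).
Proof.
move=> [CK cC cKC] oU oV CUV UV0; split; first by move=> z [/CK].
  suff -> : C `&` U = C `&` ~` V by apply: closedI => //; exact: open_closedC.
  apply/seteqP; split=> z [Cz]; last by move=> nV; split => //; case: (CUV z Cz).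
  by move=> Uz; split => // Vz; rewrite -[False]/(set0 z) -UV0.
suff -> : K `\` (C `&` U) = (K `\` C) `|` (C `&` ~` U).
  by apply: closedU => //; apply: closedI => //; exact: open_closedC.
apply/seteqP; split=> z.
  move=> [Kz nCU]; have [Cz|nCz] := pselect (C z); last by left.
  by right; split => // Uz; apply: nCU.
by move=> [[Kz nC]|[Cz nU]]; split; [|case|exact: CK|case].
Qed.

(** The intersection Q of the relatively clopen sets around x is connected: if
    it split into two nonempty closed pieces, open sets U and V separating them
    would cover some relatively clopen C around x, and the trace on C of the
    one that contains x would be a smaller relatively clopen set, excluding a
    piece of Q. So Q = {x}, and by compactness some relatively clopen set
    around x already lies in the given open set. *)
Lemma totally_disconnected_clopen_nbhs K O x : hausdorff_space T ->
  totally_disconnected [set: T] -> compact K -> K x -> open O -> O x ->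
  exists C, [/\ relatively_clopen K C, C x & C `<=` O].
Proof.
move=> hT dT cK Kx oO Ox.
pose D := [set C | relatively_clopen K C /\ C x].
have clK : closed K by exact: compact_closed.
have DK : D K by split => //; split => //; rewrite setDv; exact: closed0.
have DI C C' : D C -> D C' -> D (C `&` C').
  by move=> [DC Cx] [DC' C'x]; split => //; exact: relatively_clopenI.
pose F := filter_from D id.
have FF : Filter F.
  apply: filter_from_filter; first by exists K.
  by move=> C C' ? ?; exists (C `&` C') => //; exact: DI.
pose Q := \bigcap_(C in D) C.
have FQ : cluster F `<=` Q.
  move=> y; rewrite clusterE => Fy C DC; have [[_ /closure_id -> _] _] := DC.
  by apply: Fy; exists C.
have small O' : open O' -> Q `<=` O' -> exists2 C, D C & C `<=` O'.
  move=> oO' QO'.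
  have [||U [C DC /= CU] UB] := @compact_avoid_cluster (K `&` ~` O') F FF.
  - by apply: compact_closedI => //; exact: open_closedC.
  - by move=> y [_ nO'] /FQ /QO'.
  exists C => // y Cy; apply: contrapT => nO'; rewrite -[False]/(set0 y) -UB.
  by split; [apply/subset_closure/CU | split => //; case: DC => -[CK _ _] _; exact: CK].
have QK : Q `<=` K by move=> y; apply.
have cQ : closed Q by apply: closed_bigI => C [[]].
have Qx : Q x by move=> C [].
have half U V : open U -> open V -> Q `<=` U `|` V -> U `&` V = set0 -> U x ->
    Q `<=` U.
  move=> oU oV QUV UV0 Ux; have [C [DC Cx] CUV] := small _ (openU oU oV) QUV.
  move=> y /(_ (C `&` U)) [] //; split => //; exact: relatively_clopen_split UV0.
have Qconn : connected Q.
  apply: contrapT => /connectedPn[E [E0 QE sepE]].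
  have EQ b : E b `<=` Q by rewrite QE; case: b => z Ez; [right|left].
  have cE b : compact (E b).
    apply: subclosed_compact cK _; last exact: subset_trans (EQ b) QK.
    have clQ : closure (E b) `<=` Q.
      by rewrite [Q](iffLR (closure_id _) cQ); exact: closureS.
    rewrite (_ : E b = closure (E b)); first exact: closed_closure.
    apply/seteqP; split; first exact: subset_closure.
    case: sepE => s1 s2 z clz; have := clQ z clz; rewrite {1}QE.
    case: b {clQ} clz => clz [] // Ez; exfalso.
    - by rewrite -[False]/(set0 z) -s2.
    - by rewrite -[False]/(set0 z) -s1.
  have [U [V [oU oV EU EV UV0]]] :=
    compact_separated hT (cE false) (cE true) (separated_disjoint sepE).
  have QUV : Q `<=` U `|` V by rewrite QE; exact: setUSS.
  have nUV z : U z -> V z -> False by move=> Uz Vz; rewrite -[False]/(set0 z) -UV0.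
  have [u Eu] := E0 false; have [v Ev] := E0 true.
  case: (QUV x Qx) => [Ux|Vx].
    by apply: (nUV v) (EV v Ev); apply: (half U V) => //; exact: EQ Ev.
  apply: (nUV u) (EU u Eu) _.
  by apply: (half V U) => //; [rewrite setUC|rewrite setIC|exact: EQ Eu].
have Q1 : Q `<=` [set x].
  by rewrite -(dT x I); exact: connected_component_max.
have QO : Q `<=` O by move=> y /Q1 ->.
by have [C [DC Cx] CO] := small O oO QO; exists C.
Qed.

End QuasiComponents.

(** * Van Dantzig's theorem *)

Section TopologicalGroups.
Variable G : topologicalGroupType.
Implicit Types (U S K C O W : set G) (x y g h : G).
Local Open Scope group_scope.

Lemma mulg_cvg (I : Type) (F : set_system I) (f h : I -> G) a b :
  Filter F -> f @ F --> a -> h @ F --> b -> (fun i => f i * h i) @ F --> a * b.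
Proof.
move=> FF fa hb.
apply: (@cvg_comp _ _ _ (fun i => (f i, h i)) (fun z => z.1 * z.2)).
  exact: cvg_pair fa hb.
exact: (@mulg_continuous G (a, b)).
Qed.

Lemma mulg_continuousr g : continuous (fun x => x * g).
Proof. by move=> x; apply: mulg_cvg; [exact: cvg_id|exact: cvg_cst]. Qed.

Lemma mulg_continuousl g : continuous (fun x => g * x).
Proof. by move=> x; apply: mulg_cvg; [exact: cvg_cst|exact: cvg_id]. Qed.

Lemma compact_mulset U S : compact U -> compact S -> compact (mulset U S).
Proof.
move=> cU cS.
have -> : mulset U S = (fun z : G * G => z.1 * z.2) @` (U `*` S).
  apply/seteqP; split => [_ [x Ux [y Sy <-]]|_ [[x y] [/= Ux Sy] <-]].
    by exists (x, y).
  by exists x => //; exists y.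
apply: continuous_compact; last exact: compact_setX.
exact/continuous_subspaceT/mulg_continuous.
Qed.

Lemma compact_translate g U : compact U -> compact [set g * x | x in U].
Proof.
move=> cU; apply: continuous_compact => //.
exact/continuous_subspaceT/mulg_continuousl.
Qed.

(** The map sending (u, v, s, w) to u v s w is continuous, and its value at
    (u, 1, s, 1) lies in O for every u in U and s in S; compactness of U x S
    makes the neighbourhood of (1, 1) uniform. *)
Lemma mulset_thicken U S O : compact U -> compact S -> open O ->
  mulset U S `<=` O ->
  exists2 V, nbhs 1 V & forall u v s w, U u -> V v -> S s -> V w ->
    O (u * v * s * w).
Proof.
move=> cU cS oO USO.
have /compact_near_coveringP cUS := compact_setX cU cS.
have /(cUS _ (nbhs ((1, 1) : G * G))
    (fun vw us => O (us.1 * vw.1 * us.2 * vw.2))) : forall us, (U `*` S) us ->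
    \forall us' \near us & vw \near nbhs ((1, 1) : G * G),
      O (us'.1 * vw.1 * us'.2 * vw.2).
  move=> [u s] [/= Uu Ss].
  have us1 : O (u * 1 * s * 1).
    by rewrite !mulg1; apply: USO; exists u => //; exists s.
  have c : (fun z : (G * G) * (G * G) => z.1.1 * z.2.1 * z.1.2 * z.2.2) @
      nbhs ((u, s), (1, 1) : G * G) --> u * 1 * s * 1.
    have c1 : fst @ nbhs ((u, s), (1, 1) : G * G) --> (u, s) by exact: cvg_fst.
    have c2 : snd @ nbhs ((u, s), (1, 1) : G * G) --> ((1, 1) : G * G).
      exact: cvg_snd.
    apply: mulg_cvg; last exact: cvg_comp c2 cvg_snd.
    apply: mulg_cvg; last exact: cvg_comp c1 cvg_snd.
    by apply: mulg_cvg; [exact: cvg_comp c1 cvg_fst|exact: cvg_comp c2 cvg_fst].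
  exact: c (open_nbhs_nbhs (conj oO us1)).
case=> [[V W] /= [V1 W1] VWO]; exists (V `&` W); first exact: filterI.
move=> u v s w Uu [Vv _] Ss [_ Ww].
exact: (VWO (v, w) (conj Vv Ww) (u, s) (conj Uu Ss)).
Qed.

Lemma subgroup_open K : is_subgroup K -> nbhs 1 K -> open K.
Proof.
move=> [K1 KM KV] nK; rewrite openE => g Kg; rewrite /interior.
have : nbhs g ((fun x => g^-1 * x) @^-1` K).
  by apply: mulg_continuousl; rewrite mulVg.
by apply: filterS => x /= Kx; rewrite -(mulVKg g x); exact: KM.
Qed.

(** The complement of a subgroup is a union of cosets. *)
Lemma open_subgroup_closed K : is_subgroup K -> open K -> closed K.
Proof.
move=> [K1 KM KV] oK; rewrite -[K]setCK; apply: open_closedC.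
rewrite openE => g nKg; rewrite /interior.
have : nbhs g ((fun x => g^-1 * x) @^-1` K).
  by apply: mulg_continuousl; rewrite mulVg; exact: open_nbhs_nbhs.
apply: filterS => x /= Kx Kx'; apply: nKg.
by rewrite -[g]invgK -(mulgK x g^-1); exact: KV _ (KM _ _ Kx (KV _ Kx')).
Qed.

(** Van Dantzig's theorem. A compact open C with 1 in C and C contained in W
    exists by [totally_disconnected_clopen_nbhs]; the g such that Cg and
    C g^-1 are contained in C form a subgroup inside C, which is open because
    it contains a neighbourhood of 1 by [mulset_thicken]. *)
Lemma compact_open_subgroup_nbhs W : locally_compact_group G ->
  totally_disconnected [set: G] -> nbhs 1 W ->
  exists K, [/\ is_subgroup K, open K, compact K & K `<=` W].
Proof.
move=> [hG lcG] dG; rewrite nbhsE => -[V [oV V1] VW].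
have [N nN [cN clN]] : exists2 N, nbhs (1 : G) N & compact N /\ closed N.
  have [N nN cN] := lcG 1 I; exists N => //.
  by move: nN; rewrite /within /=; apply: filterS => x; apply.
have N1 : N 1 by exact: nbhs_singleton.
have [] := @totally_disconnected_clopen_nbhs _ N (V `&` interior N) 1 hG dG cN N1.
- by apply: openI => //; exact: open_interior.
- by split.
move=> C [[CN clC clNC] C1 CVN].
have cC : compact C by exact: subclosed_compact cN CN.
(* C is open in G, not only in N, as it lies in the interior of N. *)
have oC : open C.
  suff -> : C = interior N `&` ~` (N `\` C).
    by apply: openI; [exact: open_interior|exact: closed_openC].
  apply/seteqP; split => [x Cx|x [nx]].
    by split; [case: (CVN x Cx)|case].
  move=> /= nNC; apply: contrapT => nC; apply: nNC.
  by split => //; exact: interior_subset.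
pose P g := forall c, C c -> C (c * g).
have nP : nbhs 1 P.
  have [|V' V'1 VC] := @mulset_thicken C [set 1] C cC (@compact_set1 _ 1) oC.
    by move=> _ [c Cc [_ -> <-]]; rewrite mulg1.
  apply: (filterS _ V'1) => v Vv c Cc.
  by have := VC c v 1 1 Cc Vv erefl (nbhs_singleton V'1); rewrite !mulg1.
pose K := [set g | P g /\ P g^-1].
have sK : is_subgroup K.
  split; first by split=> c; rewrite ?invg1 mulg1.
  - move=> x y [Px Px'] [Py Py']; split=> c Cc; rewrite ?invgM mulgA.
      exact/Py/Px.
    exact/Px'/Py'.
  - by move=> x [Px Px']; split; rewrite ?invgK.
have oK : open K.
  apply: subgroup_open => //; apply: filterI => //.
  by apply: (@invg_continuous G 1); rewrite /= invg1.
have KC : K `<=` C by move=> g [Pg _]; rewrite -(mul1g g); exact: Pg.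
exists K; split => //; last by move=> x /KC /CVN [/VW].
by apply: subclosed_compact cC KC; exact: open_subgroup_closed.
Qed.

End TopologicalGroups.

(** * Haar measure on a coset space *)

(** pi is, up to a bijection of V, the projection of G onto the left cosets of
    K. Stating it abstractly covers both the orbit maps of an action and the
    projection onto the coset space itself. *)
Record coset_map (G : topologicalGroupType) (V : choiceType) (K : set G)
    (pi : G -> V) : Prop := {
  coset_subgroup : is_subgroup K ;
  coset_open : open K ;
  coset_compact : compact K ;
  coset_eq : forall g h, pi g = pi h <-> K (g^-1 * h)%g ;
  coset_surj : forall x, exists g, pi g = x
}.

Section BorelSets.
Variable G : topologicalGroupType.
Implicit Types O C : set G.

Lemma open_measurable_borel O :
  open O -> measurable (O : set (borel G)).
Proof. by move=> oO; exact: sub_sigma_algebra. Qed.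

Lemma compact_measurable_borel C :
  hausdorff_space G -> compact C -> measurable (C : set (borel G)).
Proof.
move=> hG cC; rewrite -[C]setCK; apply: measurableC.
exact: open_measurable_borel (closed_openC (compact_closed hG cC)).
Qed.

End BorelSets.

Section CosetMap.
Variables (G : topologicalGroupType) (V : choiceType) (K : set G).
Variables (pi : G -> V) (piP : coset_map K pi).
Implicit Types (A : set V) (C : set G).

Lemma coset_fibre g : pi @^-1` [set pi g] = [set (g * x)%g | x in K].
Proof.
apply/seteqP; split => [h /= /esym /(coset_eq piP) Kh|_ [k Kk <-]].
  by exists (g^-1 * h)%g => //; rewrite mulVKg.
by apply/esym/(coset_eq piP); rewrite mulKg.
Qed.

Lemma open_coset_preimage A : open (pi @^-1` A).
Proof.
rewrite openE => g Ag; rewrite /interior.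
have K1 : nbhs (g^-1 * g)%g K.
  rewrite mulVg; apply: open_nbhs_nbhs; split; first exact: coset_open piP.
  by case: (coset_subgroup piP).
have : nbhs g ((fun x => g^-1 * x)%g @^-1` K) by exact: mulg_continuousl.
by apply: filterS => h /= /(coset_eq piP) <-.
Qed.

Lemma compact_coset_preimage A : finite_set A -> compact (pi @^-1` A).
Proof.
move=> fA; rewrite -[A]fset_setK//.
have -> : pi @^-1` [set` fset_set A] =
    \bigcup_(x in [set` fset_set A]) pi @^-1` [set x].
  by apply/seteqP; split => [g Ag|g [x Ax /= ->]]; first exists (pi g).
rewrite bigcup_fset; apply: bigsetU_compact => x _.
have [g <-] := coset_surj piP x; rewrite coset_fibre.
exact/compact_translate/(coset_compact piP).
Qed.

Lemma finite_coset_image C : compact C -> finite_set (pi @` C).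
Proof.
rewrite compact_cover => /(_ V (pi @` C) (fun x => pi @^-1` [set x])) [].
- by move=> x _; exact: open_coset_preimage.
- by move=> g Cg; exists (pi g) => //; exists g.
move=> D _ CD; apply: (sub_finite_set _ (finite_fset D)) => _ [g Cg <-].
by have [x Dx ->] := CD g Cg.
Qed.

Variables (R : realType) (mu : {measure set (borel G) -> \bar R}).
Hypothesis muP : left_haar_measure mu.
Local Open Scope ereal_scope.

(** The preimage is a disjoint union of |A| left translates of K. *)
Lemma haar_coset_preimage A : finite_set A ->
  mu (pi @^-1` A) = (#|` fset_set A|%:R)%:E * mu K.
Proof.
move=> fA.
have mK : mu K \is a fin_num.
  by rewrite ge0_fin_numE//; exact: haar_compact muP _ (coset_compact piP).
have -> : pi @^-1` A = \bigcup_(x in A) pi @^-1` [set x].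
  by apply/seteqP; split => [g Ag|g [x Ax /= ->]]; first exists (pi g).
rewrite measure_fin_bigcup//; last 2 first.
- by move=> x y _ _ [g [/= <- <-]].
- by move=> x _; apply: open_measurable_borel; exact: open_coset_preimage.
rewrite fsbig_finite//= (eq_bigr (fun=> (fine (mu K))%:E)); last first.
  move=> x _; rewrite fineK//; have [g <-] := coset_surj piP x.
  rewrite coset_fibre; apply: (haar_invariant muP).
  exact: open_measurable_borel (coset_open piP).
rewrite sumEFin big_const_seq count_predT iter_addr_0.
by rewrite -{2}(fineK mK) -EFinM mulr_natl.
Qed.

(** Finitely many translates of K cover any compact set, so if K were null then
    so would be every compact set, and G itself by inner regularity. *)
Lemma haar_coset_gt0 : hausdorff_space G -> 0 < mu K.
Proof.
move=> hG; rewrite lt_def measure_ge0 andbT; apply/negP => /eqP K0.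
have := haar_neq0 muP; rewrite (haar_inner muP openT) ltNge => /negP; apply.
apply: ge_ereal_sup => _ [C [cC _] <-].
have fC := finite_coset_image cC.
rewrite [leRHS](_ : _ = mu (pi @^-1` (pi @` C))); last first.
  by rewrite haar_coset_preimage// K0 mule0.
apply: le_measure; rewrite ?inE; last by move=> g Cg; exists g.
  exact: compact_measurable_borel.
exact: open_measurable_borel (open_coset_preimage _).
Qed.


End CosetMap.

(** * Proper transitive actions as coset spaces *)

Section OrbitMap.
Variables (G : topologicalGroupType) (Gamma : graph).
Variable (act : G -> Gamma -> Gamma).
Hypothesis actP : graph_action act.
Local Open Scope group_scope.

Lemma actK g : cancel (act g) (act g^-1).
Proof. by move=> x; rewrite -(actionM actP) mulVg (action1 actP). Qed.

Lemma actKV g : cancel (act g^-1) (act g).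
Proof. by move=> x; rewrite -(actionM actP) mulgV (action1 actP). Qed.

(** Pointwise convergence to a discrete space: evaluation at x is continuous and
    the singleton of x is a neighbourhood of x. *)
Lemma nbhs_stabiliser x : nbhs 1 [set g | act g x = x].
Proof.
have c : (fun g => act g x : discrete_topology Gamma) @ (1 : G)
    --> (act 1 x : discrete_topology Gamma).
  apply: (@cvg_comp _ _ _
    (act : G -> {ptws Gamma -> discrete_topology Gamma}) (proj x)).
    exact: (action_continuous actP).
  exact: (@proj_continuous Gamma (fun=> discrete_topology Gamma) x (act 1)).
have : nbhs (act 1 x : discrete_topology Gamma) [set x].
  rewrite (action1 actP); apply: open_nbhs_nbhs; split => //.
  exact: discrete_open.
by move/c.
Qed.

Lemma orbit_coset_map x0 : proper_action act ->
  [set act g x0 | g in [set: G]] = [set: Gamma] ->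
  coset_map [set g | act g x0 = x0] (fun g => act g x0).
Proof.
move=> act_proper act_trans.
have sK : is_subgroup [set g | act g x0 = x0].
  split => /=; first exact: action1.
    by move=> g h gx hx; rewrite (actionM actP) hx.
  by move=> g gx; rewrite -[in LHS]gx actK.
split => //.
- by apply: subgroup_open => //; exact: nbhs_stabiliser.
- move=> g h /=; rewrite (actionM actP); split => [<-|gh]; first exact: actK.
  by rewrite -[in LHS]gh actKV.
- move=> x; have : [set: Gamma] x by [].
  by rewrite -act_trans => -[g _ <-]; exists g.
Qed.

End OrbitMap.

(** * From graphs to the Folner constant *)

Section FolnerStar.
Variables (R : realType) (G : topologicalGroupType).
Variable mu : {measure set (borel G) -> \bar R}.
Hypothesis muP : left_haar_measure mu.
Hypothesis hG : hausdorff_space G.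
Local Open Scope ereal_scope.

Lemma folner_star_ge0 : 0 <= folner_star mu.
Proof.
apply: le_ereal_inf_tmp => _ [S _ <-].
apply: le_ereal_inf_tmp => _ [U [_ U0] <-].
by apply: mule_ge0 => //; rewrite inve_ge0; exact: ltW.
Qed.

Definition folner_ratio (Gamma : graph) (A : set Gamma) : R :=
  (#|` fset_set (vertex_boundary A)|%:R / #|` fset_set A|%:R)%R.

Lemma finite_vertex_boundary (Gamma : graph) (A : set Gamma) :
  locally_finite Gamma -> finite_set A -> finite_set (vertex_boundary A).
Proof.
move=> lf fA.
have : finite_set (\bigcup_(x in A) [set y | adj x y]) by apply: bigcup_finite.
by apply: sub_finite_set => y [_ [x Ax xy]]; exists x.
Qed.

(** The competitors S and U in the infimum are the preimages, under the orbit
    map of a base vertex, of the closed unit ball at that vertex and of A; then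
    US \ U is the preimage of the vertex boundary. *)
Lemma folner_star_le (Gamma : graph) (A : set Gamma) :
  connected_graph Gamma -> locally_finite Gamma ->
  admits_proper_transitive_action G Gamma -> finite_set A -> A !=set0 ->
  folner_star mu <= (folner_ratio A)%:E.
Proof.
move=> Gconn lf [act [actP act_proper [x0 act_trans]]] fA [a Aa].
have piP := orbit_coset_map actP act_proper act_trans.
move: piP; set K := [set g | _]; set pi := (fun g => _) => piP.
pose N := x0 |` [set y | adj x0 y].
have actM := actionM actP; have adjP := action_adj actP.
(* s = g^-1 h belongs to S exactly when right multiplication by s moves the
   vertex of g to itself or to a neighbour. *)
have N_adj g h : N (pi (g^-1 * h)%g) <-> pi h = pi g \/ adj (pi g) (pi h).
  rewrite /N /pi /= actM -(adjP g x0) (actKV actP).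
  split => -[e|e]; [left|by right|left|by right].
    by rewrite -[in RHS]e (actKV actP).
  by rewrite e (actK actP).
have SV s : N (pi s) -> N (pi s^-1%g).
  have := N_adj 1%g s; rewrite invg1 mul1g => /iffLR/[apply].
  have := N_adj s 1%g; rewrite mulg1 adj_sym => sN [e|e]; apply/sN.
    by left.
  by right.
have [g0 g0a] := coset_surj piP a.
have U0 : 0 < mu (pi @^-1` A).
  rewrite (haar_coset_preimage piP muP fA).
  apply: mule_gt0; last exact: (haar_coset_gt0 piP muP hG).
  rewrite lte_fin ltr0n cardfs_gt0; apply/fset0Pn; exists a.
  by rewrite in_fset_set// inE.
have fB := finite_vertex_boundary lf fA.
apply: ge_ereal_inf; eexists.
  exists (pi @^-1` N) => //; split.
  - by apply: (compact_coset_preimage piP); rewrite finite_setU; split.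
  - apply/seteqP; split => [_ [s Ns <-]|s Ns]; first exact: SV.
    by exists (s^-1)%g; [exact: SV|rewrite invgK].
  - apply/seteqP; split => // g _ H [[H1 HM HV] SH].
    (* A subgroup containing S contains g: follow a path from x0 to g x0. *)
    have step h h' : H h -> pi h' = pi h \/ adj (pi h) (pi h') -> H h'.
      by move=> Hh /N_adj /SH Hs; rewrite -(mulVKg h h'); exact: HM.
    have [p []] := Gconn (pi 1%g) (pi g).
    elim: p 1%g H1 => [|y p IHp] h Hh /=.
      by move=> _ e; apply: (step h) => //; left.
    have [h' <-] := coset_surj piP y.
    move=> /andP[hh' pathp] e; apply: (IHp h') => //.
    by apply: (step h) => //; right.
apply: ge_ereal_inf; eexists.
  exists (pi @^-1` A) => //; split => //.
  exact: (compact_coset_preimage piP).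
rewrite (_ : mulset _ _ `\` _ = pi @^-1` (vertex_boundary A)); last first.
  apply/seteqP; split => [_ [[u Au [s Ns <-]] nA]|h [nA [x Ax xh]]].
    split => //; exists (pi u) => //.
    have /N_adj[e|//] : N (pi (u^-1 * (u * s))%g) by rewrite mulKg.
    by case: nA; rewrite /preimage /= e.
  split => //; have [u ux] := coset_surj piP x.
  exists u; first by rewrite /preimage /= ux.
  by exists (u^-1 * h)%g; [apply/N_adj; right; rewrite ux|rewrite mulVKg].
have K0 := haar_coset_gt0 piP muP hG.
have Kfin : mu K \is a fin_num.
  by rewrite ge0_fin_numE//; exact: haar_compact muP _ (coset_compact piP).
move: U0; rewrite !(haar_coset_preimage piP muP)// -(fineK Kfin) -!EFinM lte_fin => U0.
rewrite inver gt_eqF// -EFinM lee_fin /folner_ratio.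
have Kr : (fine (mu K) != 0)%R by rewrite gt_eqF// fine_gt0// K0 ltey_eq Kfin.
by rewrite -mulf_div divff// mulr1.
Qed.

End FolnerStar.

(** * Cayley-Abels graphs *)

Section CosetGraph.
Variables (G : topologicalGroupType) (K S : set G).
Hypotheses (K_subgroup : is_subgroup K).
Hypotheses (K_open : open K) (K_compact : compact K).
Hypotheses (S_compact : compact S) (S_sym : symmetric_set S).
Hypotheses (S_gen : generates S).
Implicit Types (g h s : G).
Local Open Scope group_scope.

Definition lcoset_set g : set G := [set h | K (g^-1 * h)].

Definition coset_space : choiceType := set_type (range lcoset_set).

Definition to_coset g : coset_space :=
  exist _ (lcoset_set g) (mem_set (imageT lcoset_set g)).

Lemma to_coset_surj (x : coset_space) : exists g, to_coset g = x.
Proof.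
have [g _ gx] := set_mem (svalP x); exists g.
by apply: val_inj.
Qed.

Lemma to_coset_eq g h : to_coset g = to_coset h <-> K (g^-1 * h).
Proof.
have [K1 KM KV] := K_subgroup.
split=> [/(congr1 val) /= gh|Kgh].
  by rewrite -[K _]/(lcoset_set g h) gh /lcoset_set /= mulVg.
apply: val_inj; apply/seteqP; split => x /= Kx; rewrite /lcoset_set /=.
  have -> : h^-1 * x = (g^-1 * h)^-1 * (g^-1 * x).
    by rewrite invgM invgK -mulgA mulVKg.
  by apply: (KM) => //; exact: KV.
have -> : g^-1 * x = (g^-1 * h) * (h^-1 * x) by rewrite -mulgA mulVKg.
exact: KM.
Qed.

Lemma to_coset_map : coset_map K to_coset.
Proof. by split=> //; [exact: to_coset_eq|exact: to_coset_surj]. Qed.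

(** As g and h range over all representatives, this says that g^-1 h lies in
    KSK; loops are removed because S may meet K. *)
Definition coset_adj (x y : coset_space) : bool :=
  (x != y) &&
  `[< exists g h, [/\ to_coset g = x, to_coset h = y & S (g^-1 * h)] >].

Lemma symmetric_inv s : S s -> S s^-1.
Proof. by move=> Ss; rewrite -S_sym; exists s. Qed.

Lemma coset_adj_sym : symmetric coset_adj.
Proof.
have half x y : coset_adj x y -> coset_adj y x.
  move=> /andP[xy /asboolP[g [h [gx hy Sgh]]]]; rewrite /coset_adj eq_sym xy /=.
  apply/asboolP; exists h, g; split => //.
  by have := symmetric_inv Sgh; rewrite invgM invgK.
by move=> x y; apply/idP/idP; exact: half.
Qed.

Lemma coset_adj_irr : irreflexive coset_adj.
Proof. by move=> x; rewrite /coset_adj eqxx. Qed.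

Definition coset_graph : graph := Graph coset_adj_sym coset_adj_irr.

(** Translation, computed on a chosen representative of the coset: [1] is the
    default value of [xget], whose predicate is inhabited by
    [to_coset_surj]. *)
Definition coset_act g (x : coset_graph) : coset_graph :=
  to_coset (g * xget 1 [set h | to_coset h = x]).

Lemma coset_actE g h : coset_act g (to_coset h) = to_coset (g * h).
Proof.
apply/to_coset_eq.
have /= /to_coset_eq : [set h' | to_coset h' = to_coset h]
    (xget 1 [set h' | to_coset h' = to_coset h]).
  by apply: (@xgetPex _ 1 [set h' | to_coset h' = to_coset h]); exists h.
by rewrite invgM mulgA mulgVK.
Qed.

Lemma coset_adj_act g x y :
  coset_adj x y -> coset_adj (coset_act g x) (coset_act g y).
Proof.
move=> /andP[xy /asboolP[h [h' [hx hy Shh']]]]; apply/andP; split.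
  apply: contra_neq xy; rewrite -hx -hy !coset_actE => /to_coset_eq.
  by rewrite invgM -mulgA mulKg => /to_coset_eq.
apply/asboolP; exists (g * h), (g * h'); rewrite -hx -hy !coset_actE; split => //.
by rewrite invgM -mulgA mulKg.
Qed.

Lemma coset_graph_action : graph_action coset_act.
Proof.
have [K1 KM KV] := K_subgroup.
have act1 x : coset_act 1 x = x.
  by have [g <-] := to_coset_surj x; rewrite coset_actE mul1g.
have actM g h x : coset_act (g * h) x = coset_act g (coset_act h x).
  by have [h' <-] := to_coset_surj x; rewrite !coset_actE mulgA.
split => //.
- move=> g x y; apply/idP/idP; last exact: coset_adj_act.
  by move=> /(coset_adj_act g^-1); rewrite -!actM mulVg !act1.
- move=> g; apply/cvg_sup => x; apply/cvg_image.
    by apply/seteqP; split => // y _; exists (fun=> y).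
  move=> W /= gW.
  have gxW : W (coset_act g x) by move: gW; exact: nbhs_singleton.
  exists [set f | W (f x)].
    have [h hx] := to_coset_surj x.
    have : nbhs g ((fun k => k * h) @^-1` (to_coset @^-1` [set coset_act g x])).
      apply: mulg_continuousr; apply: open_nbhs_nbhs; split.
        exact: open_coset_preimage to_coset_map _.
      by rewrite /preimage /= -coset_actE hx.
    by apply: filterS => k /=; rewrite -coset_actE hx => ->.
  apply/seteqP; split => [_ [f Wf <-] //|y Wy]; by exists (fun=> y).
Qed.

Lemma coset_graph_proper_transitive :
  admits_proper_transitive_action G coset_graph.
Proof.
exists coset_act; split; first exact: coset_graph_action.
- move=> x; have [h <-] := to_coset_surj x.
  have -> : [set g | coset_act g (to_coset h) = to_coset h] =
      (fun g => g * h) @^-1` (to_coset @^-1` [set to_coset h]).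
    by apply/seteqP; split => g; rewrite /preimage /= coset_actE.
  rewrite (_ : _ @^-1` _ = (fun g => g * h^-1) @` (to_coset @^-1` [set to_coset h])).
    apply: continuous_compact.
      exact/continuous_subspaceT/mulg_continuousr.
    exact: (compact_coset_preimage to_coset_map).
  apply/seteqP; split => [g gh|_ [g gh <-]]; last by rewrite /preimage /= mulgVK.
  by exists (g * h) => //; rewrite mulgK.
- exists (to_coset 1); apply/seteqP; split => // x _.
  by have [g <-] := to_coset_surj x; exists g => //; rewrite coset_actE mulg1.
Qed.

Lemma coset_adjP g h : coset_adj (to_coset g) (to_coset h) ->
  exists k s k', [/\ K k, S s, K k' & h = g * k * s * k'].
Proof.
move=> /andP[_ /asboolP[a [b [/esym/to_coset_eq Kga /to_coset_eq Kbh Sab]]]].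
exists (g^-1 * a), (a^-1 * b), (b^-1 * h); split => //.
by rewrite mulVKg mulVKg mulVKg.
Qed.

Lemma coset_graph_locally_finite : locally_finite coset_graph.
Proof.
move=> x; have [g <-] := to_coset_surj x.
pose C := mulset (mulset (mulset [set g] K) S) K.
have cC : compact C.
  by do 3 (apply: compact_mulset => //); exact: compact_set1.
apply: sub_finite_set (finite_coset_image to_coset_map cC) => y.
have [h <-] := to_coset_surj y => /coset_adjP[k [s [k' [Kk Ss Kk' ->]]]].
exists (g * k * s * k') => //; exists (g * k * s); last by exists k'.
by exists (g * k); [exists g => //; exists k|exists s].
Qed.

(** The g such that every coset hK is joined to hgK form a subgroup that
    contains S. *)
Lemma coset_graph_connected : connected_graph coset_graph.
Proof.
pose H : set G := [set g | forall h, exists p : seq coset_graph,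
  path coset_adj (to_coset h) p /\ last (to_coset h) p = to_coset (h * g)].
have HS : S `<=` H.
  move=> s Ss h; have [e|ne] := eqVneq (to_coset h) (to_coset (h * s)).
    by exists [::].
  exists [:: to_coset (h * s)]; split => //=; rewrite andbT /coset_adj ne /=.
  by apply/asboolP; exists h, (h * s); rewrite mulKg.
have Hsub : is_subgroup H.
  split.
  - by move=> h; exists [::]; rewrite mulg1.
  - move=> g g' Hg Hg' h; have [p [hp lp]] := Hg h; have [q [hq lq]] := Hg' (h * g).
    by exists (p ++ q); rewrite cat_path last_cat lp mulgA; split => //; apply/andP.
  - move=> g Hg h; have [p [hp lp]] := Hg (h * g^-1).
    rewrite mulgVK in lp; exists (rev (belast (to_coset (h * g^-1)) p)); split.
      rewrite -lp rev_path; apply: sub_path hp => x y; rewrite /=.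
      by rewrite coset_adj_sym.
    case: p lp {hp} => [<- //|x p] lp.
    by rewrite /= rev_cons last_rcons.
have HT g : H g.
  have : [set: G] g by []; rewrite -S_gen; apply; split => //.
move=> x y; have [g <-] := to_coset_surj x; have [h <-] := to_coset_surj y.
by have := HT (g^-1 * h) g; rewrite mulVKg.
Qed.

End CosetGraph.

(** * From the Folner constant to graphs *)

Section AmenableGraphs.
Variables (R : realType) (G : topologicalGroupType).
Variable mu : {measure set (borel G) -> \bar R}.
Hypothesis muP : left_haar_measure mu.
Hypotheses (lcG : locally_compact_group G).
Hypotheses (tdG : totally_disconnected [set: G]).
Local Open Scope ereal_scope.

(** Outer regularity is applied to US, with the slack e mu U - mu (US \ U) as
    margin. *)
Lemma haar_thicken (U S : set G) (e : R) : compact U -> compact S -> 0 < mu U ->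
  mu (mulset U S `\` U) / mu U < e%:E ->
  exists O : set G, [/\ open O, mulset U S `<=` O & mu (O `\` U) < e%:E * mu U].
Proof.
move=> cU cS U0 lte.
have [hG _] := lcG.
have cUS := compact_mulset cU cS.
have mUS := compact_measurable_borel hG cUS.
have mU := compact_measurable_borel hG cU.
have fin_compact C : compact C -> mu C \is a fin_num.
  by move=> cC; rewrite ge0_fin_numE//; exact: haar_compact muP _ cC.
have Ufin := fin_compact _ cU; have USfin := fin_compact _ cUS.
have Dlt : mu (mulset U S `\` U) < e%:E * mu U.
  have u0 : (0 < fine (mu U))%R by rewrite fine_gt0// U0 ltey_eq Ufin.
  by move: lte; rewrite -(fineK Ufin) inver gt_eqF// lte_pdivrMr.
have mD : measurable (mulset U S `\` U : set (borel G)) by exact: measurableD.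
have Dfin : mu (mulset U S `\` U) \is a fin_num.
  rewrite ge0_fin_numE//; apply: lt_trans Dlt _.
  by rewrite -(fineK Ufin) -EFinM ltry.
have [_ [V [oV USV] <-] Vlt] : exists2 x,
    [set mu V | V in [set V : set G | open V /\ mulset U S `<=` V]] x &
    x < mu (mulset U S) + (e%:E * mu U - mu (mulset U S `\` U)).
  apply: ereal_inf_lt; rewrite -(haar_outer muP mUS).
  by rewrite lteDl// sube_gt0.
have mV := open_measurable_borel oV.
exists V; split => //.
have VU : mu (V `\` U) <= mu (V `\` mulset U S) + mu (mulset U S `\` U).
  have mVUS : measurable (V `\` mulset U S : set (borel G)) by exact: measurableD.
  apply: (le_trans _ (measureU2 mu mVUS mD)); apply: le_measure; rewrite ?inE.
  - exact: measurableD.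
  - exact: measurableU.
  by move=> x [Vx nUx]; have [USx|nUSx] := pselect (mulset U S x); [right|left].
apply: le_lt_trans VU _.
rewrite measureD//; last first.
  apply: lt_trans Vlt _.
  by rewrite -(fineK USfin) -(fineK Ufin) -(fineK Dfin) -EFinM -EFinB -EFinD ltry.
rewrite setIidr// -lteBrDr// lteBlDl//.
Qed.

(** The graph is the Cayley-Abels graph of S over a compact open subgroup so
    small that thickening U and S by it keeps US inside the open set of
    [haar_thicken]; the vertices in A are the cosets that meet U. *)
Lemma folner_star_lt_graph (e : R) : folner_star mu < e%:E ->
  exists (Gamma : graph) (A : set Gamma),
    [/\ connected_graph Gamma, locally_finite Gamma &
        admits_proper_transitive_action G Gamma] /\
    [/\ finite_set A, A !=set0 & (folner_ratio R A < e)%R].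
Proof.
have [hG _] := lcG.
move=> /ereal_inf_lt[_ [S [cS symS genS] <-]].
move=> /ereal_inf_lt[_ [U [cU U0] <-]] /(haar_thicken cU cS U0)[V [oV USV VU]].
have [W W1 UWSW] := mulset_thicken cU cS oV USV.
have [K [sK oK cK KW]] := compact_open_subgroup_nbhs lcG tdG W1.
have piP := to_coset_map sK oK cK.
pose Gamma := coset_graph K symS.
pose A : set Gamma := to_coset K @` U.
have fA : finite_set A := finite_coset_image piP cU.
have lfG : locally_finite Gamma by exact: coset_graph_locally_finite.
exists Gamma, A; split; [split => //|split => //].
- exact: coset_graph_connected.
- exact: coset_graph_proper_transitive.
- have : U !=set0 by apply/set0P/eqP => U00; move: U0; rewrite U00 measure0 ltxx.
  by move=> [u Uu]; exists (to_coset K u), u.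
have fB := finite_vertex_boundary lfG fA.
have K0 := haar_coset_gt0 piP muP hG.
have Kfin : mu K \is a fin_num.
  by rewrite ge0_fin_numE//; exact: haar_compact muP _ cK.
have e0 : (0 < e)%R.
  have : 0 < e%:E * mu U by exact: le_lt_trans VU.
  by rewrite pmule_lgt0.
have boundary_sub : to_coset K @^-1` (vertex_boundary A) `<=` V `\` U.
  move=> h [nAh [_ [u Uu <-] /(coset_adjP sK)[k [s [k' [Kk Ss Kk' hE]]]]]].
  split; first by rewrite hE; apply: UWSW => //; exact: KW.
  by move=> Uh; apply: nAh; exists h.
have US : U `<=` to_coset K @^-1` A by move=> u Uu; exists u.
have mpre B : measurable (to_coset K @^-1` B : set (borel G)).
  exact: open_measurable_borel (open_coset_preimage piP B).
have mU := compact_measurable_borel hG cU.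
have : mu (to_coset K @^-1` (vertex_boundary A)) < e%:E * mu (to_coset K @^-1` A).
  apply: (@le_lt_trans _ _ (mu (V `\` U))).
    apply: le_measure; rewrite ?inE//; apply: measurableD => //.
    exact: open_measurable_borel.
  apply: lt_le_trans VU _; rewrite lee_pmul2l//.
  by apply: le_measure; rewrite ?inE.
have A0 : (0 < #|` fset_set A|%:R :> R)%R.
  have : 0 < mu (to_coset K @^-1` A).
    by apply: lt_le_trans U0 _; apply: le_measure; rewrite ?inE.
  rewrite (haar_coset_preimage piP muP fA) pmule_lgt0//.
rewrite !(haar_coset_preimage piP muP)// muleA -(fineK Kfin) -!EFinM lte_fin.
rewrite ltr_pM2r; last by rewrite fine_gt0// K0 ltey_eq Kfin.
by rewrite /folner_ratio ltr_pdivrMr.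
Qed.

End AmenableGraphs.

Theorem theorem1p8 (R : realType) (G : topologicalGroupType)
    (G_locally_compact : locally_compact_group G)
    (G_compactly_generated : compactly_generated G)
    (G_totally_disconnected : totally_disconnected [set: G]%classic)
    (mu : {measure set (borel G) -> \bar R})
    (mu_haar : left_haar_measure mu) :
  folner_star mu = 0%E <->
  exists Gamma : nat -> graph,
    (forall n, [/\ connected_graph (Gamma n), locally_finite (Gamma n)
                 & admits_proper_transitive_action G (Gamma n)]) /\
    asymptotically_amenable R Gamma.
Proof.
split=> [folner0|[Gamma [GammaP [A [AP ratio0]]]]].
- have /choice[f fP] n : exists X : {Gamma : graph & set Gamma},
      [/\ connected_graph (tag X), locally_finite (tag X) &
        admits_proper_transitive_action G (tag X)] /\
      [/\ finite_set (tagged X), tagged X !=set0 &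
        folner_ratio R (tagged X) < n.+1%:R^-1].
    have [|Gamma [A GammaA]] := @folner_star_lt_graph _ _ _ mu_haar
        G_locally_compact G_totally_disconnected n.+1%:R^-1.
      by rewrite folner0 lte_fin invr_gt0.
    by exists (existT _ Gamma A).
  exists (fun n => tag (f n)); split=> [n|]; first by case: (fP n).
  exists (fun n => tagged (f n)); split=> [n|]; first by case: (fP n) => _ [].
  apply: (@squeeze_cvgr _ _ _ _ (cst 0) harmonic).
  + apply/nearW => n; case: (fP n) => _ [_ _ /ltW ratio_le].
    by rewrite ratio_le andbT /folner_ratio divr_ge0.
  + exact: cvg_cst.
  + exact: cvg_harmonic.
- have [hG _] := G_locally_compact.
  apply/eqP; rewrite eq_le folner_star_ge0 andbT.
  apply/lee_addgt0Pr => e e0; rewrite add0e.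
  have /cvgrPdist_lt /(_ e e0)[n _ /(_ n (leqnn n))] := ratio0.
  rewrite sub0r normrN => /ltW/(le_trans (ler_norm _)) ratio_le.
  have [Gconn Glf Gact] := GammaP n; have [fA A0] := AP n.
  apply: le_trans (folner_star_le mu_haar hG Gconn Glf Gact fA A0) _.
  by rewrite lee_fin.
Qed.
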